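(* Suppose the following assumptions hold. (A1) For each $n\ge 1$ and $P_{0,X}^{(\infty)}$-almost every fixed realization $\{x_i\}_{i\ge1}$ of $\{X_i\}_{i\ge1}$, $(y^{(n)},p)\mapsto L_n(p)=\prod_{i=1}^n\prod_{k=1}^K p_k(x_i)^{\mathbf 1\{y_i=y_k\}}$ is measurable on $(\mathcal Y^n\times\mathcal P,2^{\mathcal Y^n}\otimes\mathscr P)$. (A2) For each $n\ge1$ and almost every fixed realization $\{x_i\}_{i\ge1}$: the marginal law of $(p(x_1),\dots,p(x_n))$ under the prior $\Pi$ admits a density $\pi_n$, and the marginal likelihood $\int L_n(p)\,d\Pi(p)$ lies in $(0,\infty)$, a.e. $[P_0^{(n)}]$. (A3) $\Gamma$ is a compact subset of $(\mathbb R^{d_\gamma},\|\cdot\|_2)$. (A4) For each $n\ge1$ and almost every fixed realization $\{x_i\}_{i\ge1}$: $\gamma\mapsto Q_n(\gamma,p)$ is lower semicontinuous for each $p\in\mathcal P$, and $p\mapsto\inf_{\gamma\in A}Q_n(\gamma,p)$ is measurable from $(\mathcal P,\mathscr P)$ to $(\mathbb R_+,\mathcal B(\mathbb R_+))$ for each compact $A\subseteq\Gamma$. (A5) Conditionally on $P_{0,X}^{(\infty)}$-almost every fixed realization $\{x_i\}_{i\ge1}$: (1) the $Y_i$ are independent with $Y_i\sim \mathrm{Categorical}(p_0(x_i))$ for every $i\ge1$, where $p_0\in\mathcal P$; (2a) $\Gamma_{n,I}(p_0)\ne\emptyset$ for all $n\ge1$; (2b) for every $\varepsilon>0$ there exist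 $\xi>0$ and $N\ge1$ such that, for all $n\ge N$, $Q_n(\gamma,p_0)\ge\xi$ for all $\gamma\in\Gamma\setminus\Gamma_{n,I}^{\varepsilon}(p_0)$, and $\{\gamma\in\Gamma:Q_n(\gamma,p_0)\ge\xi\}$ is a compact subset of $\Gamma$. (A6) For $P_{0,X}^{(\infty)}$-almost every fixed realization $\{x_i\}_{i\ge1}$ there are semimetrics $d_n$ on $\mathcal P$, a sequence $\delta_n\downarrow0$, and sets $\mathcal P_n\subseteq\mathcal P$ ($n\ge1$) such that, with $V_{n,\delta_n}=\mathcal P_n\cap\{p:d_n(p,p_0)<\delta_n\}$: (1) $\Pi_n(p\in\mathcal P_n|Y^{(n)})\to1$ and $\Pi_n(d_n(p,p_0)<\delta_n|Y^{(n)})\to1$ in $P_0^{(n)}$-probability as $n\to\infty$; (2) $\limsup_{n\to\infty}\sup_{(\gamma,p)\in\Gamma\times V_{n,\delta_n}}|Q_n(\gamma,p)-Q_n(\gamma,p_0)|=0$; (3) for every $\varepsilon>0$ there exists $N\ge1$ such that $p\in V_{n,\delta_n}$ and $n\ge N$ imply $\Gamma_{n,I}(p)\cap B(\gamma,\varepsilon)\ne\emptyset$ for all $\gamma\in\Gamma_{n,I}(p_0)$. Then, for $P_{0,X}^{(\infty)}$-almost every fixed realization $\{x_i\}_{i\ge1}$ of $\{X_i\}_{i\ge1}$ and for every $\varepsilon>0$, $$\Pi_n\left(d_{\mathcal H}(\Gamma_{n,I}(p),\Gamma_{n,I}(p_0))\ge\varepsilon\,\middle|\,Y^{(n)}\right)\to0\quad\text{in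 }P_0^{(n)}\text{-probability as }n\to\infty.$$
   Context: $\mathcal Y=\{y_1,\dots,y_K\}$ is finite, $\mathcal X\subseteq\mathbb R^{d_x}$, $\Delta^{K-1}$ is the probability simplex in $\mathbb R^K$. $\{X_i\}_{i\ge1}$ is a sequence of $\mathcal X$-valued random vectors with law $P_{0,X}^{(\infty)}$; the analysis conditions on a realization $\{x_i\}_{i\ge1}$. $\mathcal P$ is a space of conditional PMFs $p=(p_1,\dots,p_K):\mathcal X\to\Delta^{K-1}$ with $\sigma$-algebra $\mathscr P$ and $\Pi$ is a prior, i.e. a probability measure on $(\mathcal P,\mathscr P)$. $\mathrm{Categorical}(p(x))$ is the law on $\mathcal Y$ giving mass $p_k(x)$ to $y_k$. $Y^{(n)}=(Y_1,\dots,Y_n)$ and $P_0^{(n)}=\bigotimes_{i=1}^n\mathrm{Categorical}(p_0(x_i))$, $p_0$ being the true conditional PMF. The posterior is $\Pi_n(A|Y^{(n)})=\int_A L_n\,d\Pi/\int L_n\,d\Pi$, with $L_n$ evaluated at $Y^{(n)}$; events appearing in posterior probabilities concerning $\mathcal P_n$ and $d_n$ are taken to be measurable. $\Gamma\subseteq\mathbb R^{d_\gamma}$ is the structural parameter space and $f:\mathcal X\times\Delta^{K-1}\times\Gamma\to\mathbb R^{d_f}$ a known function. The conditional identified set is $\Gamma_{n,I}(p)=\{\gamma\in\Gamma:f(x_i,p(x_i),\gamma)\in\mathbb R_+^{d_f}\ \forall i=1,\dots,n\}$. $Q_n:\Gamma\times\mathcal P\to\mathbb R_+$ is a criterion function (it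 may depend on $x_1,\dots,x_n$) depending on $p$ only through $(p(x_1),\dots,p(x_n))$ and satisfying $Q_n(\gamma,p)=0\iff f(x_i,p(x_i),\gamma)\in\mathbb R_+^{d_f}\ \forall i=1,\dots,n$; so $\Gamma_{n,I}(p)=\{\gamma\in\Gamma: Q_n(\gamma,p)=0\}$. $\mathrm{dist}$ is Euclidean distance from a point to a set ($+\infty$ for the empty set), $\Gamma_{n,I}^\varepsilon(p)=\{\gamma\in\Gamma:\mathrm{dist}(\gamma,\Gamma_{n,I}(p))<\varepsilon\}$, $B(\gamma,\varepsilon)$ is the open Euclidean ball, and $d_{\mathcal H}(\Gamma_1,\Gamma_2)=\max\{\sup_{\gamma\in\Gamma_1}\mathrm{dist}(\gamma,\Gamma_2),\sup_{\gamma\in\Gamma_2}\mathrm{dist}(\gamma,\Gamma_1)\}$ is the Hausdorff distance. Compact sets $A$ in (A4) are taken nonempty. *)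

(* Defs.v *)
From HB Require Import structures.
From mathcomp Require Import all_boot all_order all_algebra.
From mathcomp Require Import all_classical all_reals all_analysis.

Set Implicit Arguments.
Unset Strict Implicit.
Unset Printing Implicit Defensive.

Import Order.TTheory GRing.Theory Num.Theory numFieldNormedType.Exports.

Local Open Scope classical_set_scope.
Local Open Scope ring_scope.

(* Delta^{K-1}; the number of categories K is written Km1.+1 throughout. *)
Definition simplex (R : realType) (Km1 : nat) : set 'rV[R]_Km1.+1 :=
  [set v | (forall k, 0 <= v 0 k) /\ \sum_k v 0 k = 1].
Arguments simplex : clear implicits.

(** Realizations of the covariate process: the sequences (x_i) with values in
    the set X, with the product of the (trace) Borel sigma-algebras. The proof
    that X is nonempty is only there because measurable types are pointed. *)
Section covariate_paths.
Context {R : realType} {dx : nat} {X : set 'rV[R]_dx}.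

Definition covpath (X0 : X !=set0) : Type := nat -> X.

Definition covpath_display : measure_display.
Proof. exact: default_measure_display. Qed.

Variable X0 : X !=set0.

HB.instance Definition _ := gen_eqMixin (covpath X0).
HB.instance Definition _ := gen_choiceMixin (covpath X0).
HB.instance Definition _ := isPointed.Build (covpath X0)
  (fun=> exist (fun v => v \in X) (sval (cid X0)) (mem_set (svalP (cid X0)))).

Definition cylinders : set (set (covpath X0)) :=
  [set A | exists i (B : set 'rV[R]_dx),
     open B /\ A = [set x : covpath X0 | B (\val (x i))]].

HB.instance Definition _ :=
  @isMeasurable.Build covpath_display (covpath X0) <<s cylinders >>
    (@sigma_algebra0 _ setT cylinders) (@sigma_algebraC _ cylinders)
    (@sigma_algebra_bigcup _ setT cylinders).

End covariate_paths.

Definition sample (T : Type) (n : nat) (x : nat -> T) : 'I_n -> T := fun i => x i.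
Arguments sample {T} n x i.

(** The sample space Y^n with its power-set sigma-algebra; the category y_k is
    represented by its index k. *)
Section outcomes.

Definition outcomes (Km1 n : nat) : Type := n.-tuple 'I_Km1.+1.

Variables Km1 n : nat.

HB.instance Definition _ := Finite.on (outcomes Km1 n).
HB.instance Definition _ := isPointed.Build (outcomes Km1 n) [tuple ord0 | _ < n].
HB.instance Definition _ := @isMeasurable.Build default_measure_display
  (outcomes Km1 n) discrete_measurable discrete_measurable0
  discrete_measurableC discrete_measurableU.

End outcomes.

(** The product law Categorical(q_1) (x) ... (x) Categorical(q_n) on Y^n: it
    gives mass q_1(y_1) ... q_n(y_n) to the point (y_1, ..., y_n); under it the
    coordinates are independent and the i-th one is Categorical(q_i). *)
Section categorical_product.
Local Open Scope ereal_scope.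
Context {R : realType} {Km1 n : nat}.
Variable q : 'I_n -> simplex R Km1.

Definition categorical_product (A : set (outcomes Km1 n)) : \bar R :=
  \sum_(y : outcomes Km1 n) (\prod_(i < n) \val (q i) 0 (tnth y i))%R%:E * \d_y A.

End categorical_product.

(** mu^n on n.-tuple T, as an iterated binary product *)
Section tuple_measure.
Context d (T : measurableType d) (R : realType).
Variable mu : set T -> \bar R.

Fixpoint tuple_measure (n : nat) : set (n.-tuple T) -> \bar R :=
  match n with
  | 0 => dirac ([tuple] : 0.-tuple T)
  | m.+1 => pushforward (mu \x @tuple_measure m)%E
      (fun tv : T * m.-tuple T => [tuple of tv.1 :: tv.2])
  end.

End tuple_measure.
Arguments tuple_measure {d T R} mu n _.

Section prior_density.
Context {R : realType} {Km1 n : nat}.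

Definition simplex_coords (q : 'I_n -> simplex R Km1) :
    n.-tuple (Km1.-tuple (measurableTypeR R)) :=
  [tuple [tuple \val (q i) 0 (widen_ord (leqnSn Km1) k) | k < Km1] | i < n].

(** A point of the simplex is determined by its first K - 1 coordinates;
    densities on (Delta^{K-1})^n are taken with respect to the Lebesgue measure
    of R^{n (K-1)} in these coordinates. *)
Definition lebesgue_coords :=
  tuple_measure (tuple_measure (@lebesgue_measure R) Km1) n.

Definition admits_density d (T : measurableType d) (Pi : set T -> \bar R)
    (V : T -> 'I_n -> simplex R Km1) :=
  measurable_fun [set: T] (fun t => simplex_coords (V t)) /\
  exists h : n.-tuple (Km1.-tuple (measurableTypeR R)) -> R,
    [/\ measurable_fun setT h, forall v, 0 <= h v &
        forall B, measurable B ->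
          (pushforward Pi (fun t => simplex_coords (V t)) B =
          \int[lebesgue_coords]_(v in B) (h v)%:E)%E].

End prior_density.

Section euclidean.
Context {R : realType} {m : nat}.
Implicit Types (v a : 'rV[R]_m) (A B : set 'rV[R]_m).

(* The library norm on row vectors is the sup norm (with the same topology). *)
Definition norm2 v : R := Num.sqrt (\sum_i v 0 i ^+ 2).

Definition ball2 a (r : R) : set 'rV[R]_m := [set v | norm2 (v - a) < r].

(* +oo when A is empty *)
Definition dist2 v A : \bar R := ereal_inf [set (norm2 (v - a))%:E | a in A].

Definition hausdorff A B : \bar R :=
  maxe (ereal_sup [set dist2 v B | v in A]) (ereal_sup [set dist2 v A | v in B]).

End euclidean.

(* A metric, except that distinct points may be at distance zero. *)
Definition semimetric (R : realType) (T : Type) (d : T -> T -> R) :=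
  [/\ forall s t, 0 <= d s t, forall t, d t t = 0, forall s t, d s t = d t s &
      forall r s t, d r t <= d r s + d s t].

(** The space of conditional PMFs is a measurable type PP together with the
    evaluation p of its points as functions X -> Delta^{K-1} (taken injective
    where it is used, so that points of PP are such functions). The samples
    x_1, x_2, ... and y_1, y_2, ... are numbered from 0. *)
Section model.
Context {R : realType} {dx Km1 dg df : nat} {X : set 'rV[R]_dx}
  {dP : measure_display} {PP : measurableType dP}.
Variable p : PP -> X -> simplex R Km1.

Definition likelihood n (x : 'I_n -> X) (y : outcomes Km1 n) (t : PP) : R :=
  \prod_(i < n) \prod_(k < Km1.+1)
    (\val (p t (x i)) 0 k) ^+ (tnth y i == k).

(* For a likelihood with vanishing integral this is 0. *)
Definition posterior (Pi : probability PP R) n (x : 'I_n -> X)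
    (y : outcomes Km1 n) (A : set PP) : R :=
  (\int[Pi]_(t in A) likelihood x y t) / (\int[Pi]_t likelihood x y t).

Definition P0n (p0 : PP) n (x : 'I_n -> X) : set (outcomes Km1 n) -> \bar R :=
  categorical_product (fun i => p p0 (x i)).

Definition cvg_in_P0 (p0 : PP) (x : nat -> X)
    (Z : forall n, outcomes Km1 n -> R) (l : R) :=
  forall eta : R, 0 < eta ->
    P0n p0 (sample n x) [set y | eta <= `|Z n y - l|] @[n --> \oo] --> 0%E.

Variables (f : X -> simplex R Km1 -> 'rV[R]_dg -> 'rV[R]_df)
  (Gam : set 'rV[R]_dg).

Definition ident_set n (x : 'I_n -> X) (t : PP) : set 'rV[R]_dg :=
  [set g | Gam g /\ forall i j, 0 <= f (x i) (p t (x i)) g 0 j].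

Definition ident_nbhd n (x : 'I_n -> X) (eps : R) (t : PP) : set 'rV[R]_dg :=
  [set g | Gam g /\ (dist2 g (ident_set x t) < eps%:E)%E].

End model.

(* Main.v *)
(** Let [S_n], [D_n] be the two events of (A6), each of posterior probability
    tending to 1. For large [n], every [t] in both satisfies
    [d_H(Gamma_n(t), Gamma_n(p0)) <= eps / 2]: a zero [g] of [Q_n(., t)] has
    [Q_n(g, p0) < xi] by uniform convergence, hence is [eps / 2]-close to
    [Gamma_n(p0)] by separation (A5), and the other inclusion is (A6)(3). Thus
    the posterior probability of [d_H >= eps] is at most the sum of the defects
    [|Pi_n(S_n | y) - 1| + |Pi_n(D_n | y) - 1|]. *)
Require Import Defs.
From mathcomp Require Import all_boot all_order all_algebra.
From mathcomp Require Import all_classical all_reals all_analysis.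

Set Implicit Arguments.
Unset Strict Implicit.
Unset Printing Implicit Defensive.

Import Order.TTheory GRing.Theory Num.Theory numFieldNormedType.Exports.

Local Open Scope classical_set_scope.
Local Open Scope ring_scope.

(** * Integrals of a nonnegative integrable function over arbitrary sets *)

Section Rintegral_sets.
Context d (T : measurableType d) (R : realType).
Variables (mu : {measure set T -> \bar R}) (f : T -> R).
Hypothesis f0 : forall t, 0 <= f t.
Hypothesis intf : mu.-integrable setT (EFin \o f).

(* [A] need not be measurable: the integral of a nonnegative function is a
   supremum over the simple functions below it. *)
Lemma le_Rintegral_subset (A B : set T) : measurable B -> A `<=` B ->
  \int[mu]_(t in A) f t <= \int[mu]_(t in B) f t.
Proof.
move=> mB AB.
have intB : mu.-integrable B (EFin \o f).
  exact: integrableS intf.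
have le_AB : (\int[mu]_(t in A) (f t)%:E <= \int[mu]_(t in B) (f t)%:E)%E.
  rewrite !ge0_integralE; [|by move=> t _; rewrite lee_fin..].
  apply: ereal_sup_le => _ [h hA <-]; exists h => // t.
  apply: le_trans (hA t) _.
  rewrite !patchE; case: ifPn => [/set_mem /AB tB|_]; first by rewrite mem_set.
  by case: ifP; rewrite // lee_fin.
have ge0_A : (0 <= \int[mu]_(t in A) (f t)%:E)%E.
  by apply: integral_ge0 => t _; rewrite lee_fin.
(* [fine] is monotone only between finite values; the integral over [A] is finite because it lies
   between 0 and the integral over [B]. *)
apply: fine_le => //; last exact: integrable_fin_num.
rewrite ge0_fin_numE//; apply: le_lt_trans le_AB _.
by have /fin_numPlt/andP[] := integrable_fin_num mB intB.
Qed.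

(** A union bound: each bracket is the integral over a complement, and [H] lies in [~] S [|]
    ~[D]. *)
Lemma le_Rintegral_setCI (S D H : set T) : measurable S -> measurable D ->
  H `<=` ~` (S `&` D) ->
  \int[mu]_(t in H) f t <=
    (\int[mu]_t f t - \int[mu]_(t in S) f t) +
    (\int[mu]_t f t - \int[mu]_(t in D) f t).
Proof.
move=> mS mD HSD.
have mSC := measurableC mS; have mDC := measurableC mD.
have intU A : measurable A -> mu.-integrable A (EFin \o f).
  by move=> mA; exact: integrableS intf.
have splitC A : measurable A ->
    \int[mu]_t f t = \int[mu]_(t in A) f t + \int[mu]_(t in ~` A) f t.
  move=> mA; rewrite -(setUv A) Rintegral_setU//.
  - exact: measurableC.
  - by rewrite setUv.
  - exact/disj_setPCl.
rewrite [X in X - _ + _](splitC _ mS) [X in _ + (X - _)](splitC _ mD).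
rewrite ![_ + _ - _]addrAC !subrr !add0r.
have mSD : measurable (S `\` D) by exact: measurableD.
(* Taking [S]\[D] in place of [~] D[makes the union disjoint, so the integral is additive; the last
   line enlarges it back to]~[D]. *)
apply: (@le_trans _ _ (\int[mu]_(t in ~` S `|` S `\` D) f t)).
  apply: le_Rintegral_subset; first exact: measurableU.
  move=> t /HSD nSD; case: (pselect (S t)) => St; [right|by left].
  by split=> // Dt; apply: nSD.
rewrite Rintegral_setU//; last 2 first.
- by apply: intU; exact: measurableU.
- by apply/eqP; rewrite eqEsubset; split=> // t [nS [/nS]].
by rewrite lerD2l; apply: le_Rintegral_subset.
Qed.

End Rintegral_sets.

(** The limsup is an infimum, over neighbourhoods of infinity, of suprema; if it is below [l], so is
    one of these suprema. *)
Lemma limn_esup_lt_near (R : realType) (u : nat -> \bar R) (l : \bar R) :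
  (limn_esup u < l)%E -> \forall n \near \oo, (u n < l)%E.
Proof.
move=> /ereal_inf_lt[_ [V V_oo <-]] supV; apply: filterS V_oo => n Vn.
by apply: le_lt_trans supV; apply: ereal_sup_ubound; exists n.
Qed.

Section hausdorff.
Context {R : realType} {m : nat}.
Implicit Types (v w : 'rV[R]_m) (A B : set 'rV[R]_m).

Lemma norm2_distC v w : norm2 (v - w) = norm2 (w - v).
Proof.
by congr Num.sqrt; apply: eq_bigr => i _; rewrite -(opprB w v) mxE sqrrN.
Qed.

Lemma dist2_le v w A : A w -> (dist2 v A <= (norm2 (v - w))%:E)%E.
Proof. by move=> Aw; apply: ereal_inf_lbound; exists w. Qed.

Lemma hausdorff_le A B (r : \bar R) :
  (forall v, A v -> (dist2 v B <= r)%E) ->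
  (forall v, B v -> (dist2 v A <= r)%E) -> (hausdorff A B <= r)%E.
Proof.
by move=> AB BA; rewrite ge_max; apply/andP; split; apply: ge_ereal_sup;
  move=> _ [v ? <-]; [exact: AB|exact: BA].
Qed.

End hausdorff.

(** * Bounds on posterior probabilities and on the sampling law *)

Section posterior.
Context {R : realType} {dx Km1 : nat} {X : set 'rV[R]_dx}
  {dP : measure_display} {PP : measurableType dP}.
Variable p : PP -> X -> simplex R Km1.

Lemma simplex_le1 (q : simplex R Km1) k : 0 <= \val q 0 k <= 1.
Proof.
have [q0 q1] := set_mem (valP q); rewrite q0 -q1 (bigD1 k)//= lerDl.
exact: sumr_ge0.
Qed.

Lemma likelihood_ge0_le1 n (x : 'I_n -> X) (y : outcomes Km1 n) t :
  0 <= likelihood p x y t <= 1.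
Proof.
(* The exponent is 0 or 1, so each factor is 1 or a coordinate of a simplex point. *)
have pk i k : 0 <= \val (p t (x i)) 0 k ^+ (tnth y i == k) <= 1.
  by case: (_ == _); rewrite ?simplex_le1// ler01 lexx.
have pi i : 0 <= \prod_(k < Km1.+1) \val (p t (x i)) 0 k ^+ (tnth y i == k) <= 1.
  by rewrite prodr_ile1// andbT prodr_ge0// => k _; case/andP: (pk i k).
by rewrite /likelihood prodr_ile1// andbT prodr_ge0// => i _; case/andP: (pi i).
Qed.

Lemma P0n_ge0 p0 n (x : 'I_n -> X) A : (0 <= P0n p p0 x A)%E.
Proof.
apply: sume_ge0 => y _; rewrite mule_ge0// lee_fin prodr_ge0// => i _.
by case/andP: (simplex_le1 (p p0 (x i)) (tnth y i)).
Qed.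

(** [P0n] is a bare set function, so subadditivity is checked atom by atom on the indicators. *)
Lemma P0n_le_setU p0 n (x : 'I_n -> X) A B C : A `<=` B `|` C ->
  (P0n p p0 x A <= P0n p p0 x B + P0n p p0 x C)%E.
Proof.
move=> ABC; rewrite /P0n /categorical_product -big_split/=.
apply: lee_sum => y _; rewrite -ge0_muleDr//.
apply: lee_wpmul2l.
  rewrite lee_fin prodr_ge0// => i _.
  by case/andP: (simplex_le1 (p p0 (x i)) (tnth y i)).
rewrite !diracE -EFinD lee_fin -natrD ler_nat.
case: (boolP (y \in A)) => // /set_mem /ABC [] yBC.
  by rewrite (mem_set yBC).
by rewrite (mem_set yBC) addn1.
Qed.

Variables (Pi : probability PP R) (n : nat) (x : 'I_n -> X).
Variable y : outcomes Km1 n.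

Lemma posterior_ge0 A : 0 <= posterior p Pi x y A.
Proof.
have L0 t : 0 <= likelihood p x y t by case/andP: (likelihood_ge0_le1 x y t).
by rewrite divr_ge0// Rintegral_ge0.
Qed.

Hypothesis mL : measurable_fun setT (likelihood p x y).

(** This is [le_Rintegral_setCI] for the likelihood, integrable because it is measurable with values
    in [0, 1], divided by the marginal likelihood. *)
Lemma posterior_le_setCI (S D H : set PP) : measurable S -> measurable D ->
  H `<=` ~` (S `&` D) ->
  posterior p Pi x y H <=
    `|posterior p Pi x y S - 1| + `|posterior p Pi x y D - 1|.
Proof.
move=> mS mD HSD.
have L0 t : 0 <= likelihood p x y t by case/andP: (likelihood_ge0_le1 x y t).
have intL : Pi.-integrable setT (EFin \o likelihood p x y).
  apply: measurable_bounded_integrable => //; first exact: fin_num_fun_lty.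
  exists 1; split=> // M /ltW M1 t _ /=.
  by rewrite ger0_norm// (le_trans _ M1)//; case/andP: (likelihood_ge0_le1 x y t).
have := le_Rintegral_setCI L0 intL mS mD HSD.
rewrite /posterior; set I := \int[Pi]_t _.
have : 0 <= I by exact: Rintegral_ge0.
(* If [I] is 0, so is its inverse, and the left-hand side vanishes. *)
rewrite le_eqVlt => /predU1P[<-|I0] le_H.
  by rewrite invr0 mulr0 addr_ge0.
rewrite -(ler_pM2r (x := I^-1)) ?invr_gt0// mulrDl !mulrBl divff ?gt_eqF// in le_H.
by apply: le_trans le_H _; rewrite lerD// distrC ler_norm.
Qed.

End posterior.

Theorem theorem4
  (R : realType) (dx Km1 dg df : nat)
  (X : set 'rV[R]_dx) (X0 : X !=set0)
  (PX : probability (covpath X0) R)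
  (dP : measure_display) (PP : measurableType dP)
  (p : PP -> X -> simplex R Km1) (p_inj : injective p)
  (Pi : probability PP R) (p0 : PP)
  (Gam : set 'rV[R]_dg)
  (f : X -> simplex R Km1 -> 'rV[R]_dg -> 'rV[R]_df)
  (Q : forall n : nat, ('I_n -> X) -> 'rV[R]_dg -> PP -> R)
  (Q_ge0 : forall n (x : 'I_n -> X) g t, (0 < n)%N -> Gam g ->
     0 <= Q n x g t)
  (Q_local : forall n (x : 'I_n -> X) g t t', (0 < n)%N -> Gam g ->
     (forall i, p t (x i) = p t' (x i)) -> Q n x g t = Q n x g t')
  (Q_eq0 : forall n (x : 'I_n -> X) g t, (0 < n)%N -> Gam g ->
     Q n x g t = 0 <-> forall i j, 0 <= f (x i) (p t (x i)) g 0 j)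
  (A1 : forall n, (0 < n)%N -> {ae PX, forall x,
     measurable_fun [set: outcomes Km1 n * PP]
       (fun yt => likelihood p (sample n x) yt.1 yt.2)})
  (A2 : forall n, (0 < n)%N -> {ae PX, forall x,
     admits_density Pi (fun t i => p t (sample n x i)) /\
     {ae P0n p p0 (sample n x), forall y,
       (0 < \int[Pi]_t (likelihood p (sample n x) y t)%:E < +oo)%E}})
  (A3 : compact Gam)
  (A4 : forall n, (0 < n)%N -> {ae PX, forall x,
     (forall t, lower_semicontinuous
        (fun g : subspace Gam => (Q n (sample n x) g t)%:E)) /\
     (forall A, compact A -> A !=set0 -> A `<=` Gam ->
        measurable_fun [set: PP]
          (fun t => inf [set Q n (sample n x) g t | g in A]))})
  (A5 : {ae PX, forall x,
     (forall n, (0 < n)%N -> ident_set p f Gam (sample n x) p0 !=set0) /\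
     (forall eps : R, 0 < eps -> exists (xi : R) (N : nat),
        [/\ 0 < xi, (0 < N)%N & forall n, (N <= n)%N ->
          (forall g, (Gam `\` ident_nbhd p f Gam (sample n x) eps p0) g ->
             xi <= Q n (sample n x) g p0) /\
          compact [set g | Gam g /\ xi <= Q n (sample n x) g p0]])})
  (A6 : {ae PX, forall x,
     exists (d : nat -> PP -> PP -> R) (delta : nat -> R) (S : nat -> set PP),
     let D n := [set t | d n t p0 < delta n] in
     let V n := S n `&` D n in
     [/\ (forall n, (0 < n)%N ->
           [/\ semimetric (d n), measurable (S n) & measurable (D n)]) /\
         nonincreasing_seq delta /\ delta @ \oo --> 0,
         cvg_in_P0 p p0 x (fun n y => posterior p Pi (sample n x) y (S n)) 1 /\
         cvg_in_P0 p p0 x (fun n y => posterior p Pi (sample n x) y (D n)) 1,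
         limn_esup (fun n => ereal_sup
           [set `|Q n (sample n x) gt.1 gt.2 - Q n (sample n x) gt.1 p0|%:E
             | gt in Gam `*` V n]) = 0%E &
         forall eps : R, 0 < eps -> exists N : nat, (0 < N)%N /\
           forall n t, V n t -> (N <= n)%N ->
           forall g, ident_set p f Gam (sample n x) p0 g ->
             ident_set p f Gam (sample n x) t `&` ball2 g eps !=set0]}) :
  {ae PX, forall x, forall eps : R, 0 < eps ->
     cvg_in_P0 p p0 x
       (fun n y => posterior p Pi (sample n x) y
          [set t | (eps%:E <= hausdorff (ident_set p f Gam (sample n x) t)
                                        (ident_set p f Gam (sample n x) p0))%E])
       0}.
Proof.
have aeF : Filter (almost_everywhere PX) := ae_filter_ringOfSetsType PX.
have mL : {ae PX, forall x, forall n, (0 < n)%N ->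
    measurable_fun [set: outcomes Km1 n * PP]
      (fun yt => likelihood p (sample n x) yt.1 yt.2)}.
  (* The null set of (A1) varies with [n]; a countable union gives a single one. At [n = 0] the
     claim is vacuous. *)
  apply: ae_foralln => n; have [->|n0] := posnP n; first exact: aeW.
  by apply: filterS (A1 n n0) => x mL _.
apply: filterS3 mL A5 A6 => x mL [_ sepQ] [d [delta [S]]] /=.
set D := fun n => [set t | d n t p0 < delta n].
move=> [[mSD _] [cvgS cvgD] supQ lhcont] eps eps0.
pose H n := [set t | (eps%:E <= hausdorff (ident_set p f Gam (sample n x) t)
  (ident_set p f Gam (sample n x) p0))%E].
have eps20 : 0 < eps / 2 by rewrite divr_gt0.
have HSD : \forall n \near \oo, H n `<=` ~` (S n `&` D n).
  have [xi [N1 [xi0 _ far_xi]]] := sepQ _ eps20.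
  have [N2 [_ near_g]] := lhcont _ eps20.
  have supQ_lt : \forall n \near \oo, (ereal_sup
      [set `|Q n (sample n x) gt.1 gt.2 - Q n (sample n x) gt.1 p0|%:E
        | gt in Gam `*` (S n `&` D n)] < xi%:E)%E.
    by apply: limn_esup_lt_near; rewrite supQ lte_fin.
  near=> n => t /= + Vt; apply/negP; rewrite -ltNge.
  have n0 : (0 < n)%N by near: n; exact: nbhs_infty_ge.
  have N1n : (N1 <= n)%N by near: n; exact: nbhs_infty_ge.
  have N2n : (N2 <= n)%N by near: n; exact: nbhs_infty_ge.
  (* Pointwise bounds pass to the suprema only as non-strict ones; working at [eps / 2] gives the
     strict bound by [eps]. *)
  apply: (@le_lt_trans _ _ (eps / 2)%:E); last first.
    by rewrite lte_fin ltr_pdivrMr// ltr_pMr// ltr1n.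
  apply: hausdorff_le => g.
    (* If [g] were further than [eps / 2], separation would force [xi <= Q n _ g p0], while
       [Q n _ g t = 0] and the uniform gap is below [xi]. *)
    move=> [Gg fg]; apply: contrapT => /negP; rewrite -ltNge => far_g.
    have Qt0 : Q n (sample n x) g t = 0 by apply/Q_eq0.
    have : xi <= Q n (sample n x) g p0.
      apply: (far_xi n N1n).1; split=> // -[_] /ltW.
      by rewrite leNgt far_g.
    apply/negP; rewrite -ltNge -lte_fin.
    apply: le_lt_trans (near supQ_lt n _) => //.
    apply: le_trans (ereal_sup_ubound _); last by exists (g, t).
    by rewrite /= Qt0 sub0r normrN lee_fin ler_norm.
  (* The point [w] of the identified set of [t] in the ball around [g] bounds the distance. *)
  move=> /(near_g n t Vt N2n)[w [tw]]; rewrite /ball2/= norm2_distC => /ltW wg.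
  by apply: le_trans (dist2_le _ tw) _; rewrite lee_fin.
move=> eta eta0; have eta20 : 0 < eta / 2 by rewrite divr_gt0.
(* The upper bound is the sum of the probabilities that the defect of [S n], respectively [D n], is
   at least [eta / 2]. *)
apply: squeeze_cvge (cvg_cst 0%E) _; last first.
  rewrite -(adde0 0%E).
  by apply: cvgeD (cvgS _ eta20) (cvgD _ eta20).
near=> n; rewrite P0n_ge0/=.
have n0 : (0 < n)%N by near: n; exact: nbhs_infty_ge.
apply: P0n_le_setU => y /=; rewrite subr0 ger0_norm ?posterior_ge0// => eta_le.
have [_ mSn mDn] := mSD n n0.
have mLy : measurable_fun setT (likelihood p (sample n x) y).
  (* Sections of a jointly measurable function are measurable. *)
  exact: (measurable_fun_pair2 y (mL n n0)).
have HSDn : H n `<=` ~` (S n `&` D n) by near: n.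
have le_eta := le_trans eta_le (posterior_le_setCI Pi mLy mSn mDn HSDn).
(* The two defects add up to at least [eta], so they cannot both be below [eta / 2]. *)
have [S_ge|S_lt] := leP (eta / 2) `|posterior p Pi (sample n x) y (S n) - 1|.
  by left.
right; rewrite leNgt; apply/negP => D_lt.
by have := ltrD S_lt D_lt; rewrite -splitr ltNge le_eta.
Unshelve. all: by end_near.
Qed.
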